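(* Let $C_4=\{(v_1,v_2,v_3,v_4)\in\mathbb{R}^4:\ |v_1|+|v_2|+|v_3|+|v_4|\le1\}$ be the four-dimensional cross-polytope. Then $$\kappa^*(C_4)=40.$$
   Context: A lattice is a full-rank discrete subgroup $\Lambda\subset\mathbb{R}^n$. For a centrally symmetric convex body $C\subset\mathbb{R}^n$ centered at the origin ${\bf o}$, let $\|{\bf x}\|_C=\min\{r\ge0:\ {\bf x}\in rC\}$. $\Lambda$ is a packing lattice of $C$ if the translates $C+{\bf v}$, ${\bf v}\in\Lambda$, have pairwise disjoint interiors (i.e. $\|{\bf v}\|_C\ge2$ for all nonzero ${\bf v}\in\Lambda$). The lattice kissing number $\kappa^*(C)$ is the maximum, over all packing lattices $\Lambda$ of $C$, of the number of translates $C+{\bf v}$ (${\bf v}\in\Lambda\setminus\{{\bf o}\}$) touching $C$ at its boundary, i.e. of ${\rm card}\{{\bf v}\in\Lambda:\ \|{\bf v}\|_C=2\}$. *)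

(* Defs.v *)
From HB Require Import structures.
From mathcomp Require Import all_boot all_order all_algebra.
From mathcomp Require Import all_classical all_reals all_analysis.

Set Implicit Arguments.
Unset Strict Implicit.
Unset Printing Implicit Defensive.

Import Order.TTheory GRing.Theory Num.Theory.
Import numFieldNormedType.Exports.

Local Open Scope classical_set_scope.
Local Open Scope ring_scope.

Definition discrete_set {T : topologicalType} (A : set T) : Prop :=
  A `<=` isolated A.

(* The rows of B are n linearly independent vectors of L: L has full rank. *)
Definition is_lattice (R : realType) (n : nat) (L : set 'rV[R]_n) : Prop :=
  [/\ zmod_closed [in L], discrete_set L
    & exists2 B : 'M[R]_n, row_free B & forall i, L (row i B)].

(* The infimum is a minimum when C is compact and 0 is in its interior, in
   particular for every centrally symmetric convex body. *)
Definition gauge_norm (R : realType) (n : nat) (C : set 'rV[R]_n)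
    (x : 'rV[R]_n) : R :=
  inf [set r | 0 <= r /\ ( *:%R r @` C) x].

Definition translate (R : realType) (n : nat) (C : set 'rV[R]_n)
    (v : 'rV[R]_n) : set 'rV[R]_n :=
  [set x + v | x in C].

Definition packing_lattice (R : realType) (n : nat)
    (C L : set 'rV[R]_n) : Prop :=
  is_lattice L /\ trivIset L (fun v => interior (translate C v)).

Definition kissing_vectors (R : realType) (n : nat)
    (C L : set 'rV[R]_n) : set 'rV[R]_n :=
  [set v | L v /\ gauge_norm C v = 2].

(* k is the maximum, over the packing lattices L of C, of the cardinality of
   kissing_vectors C L; the bound also excludes infinite cardinalities. *)
Definition is_lattice_kissing_number (R : realType) (n : nat)
    (C : set 'rV[R]_n) (k : nat) : Prop :=
  (exists2 L, packing_lattice C L & (kissing_vectors C L #= `I_k)%card) /\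
  (forall L, packing_lattice C L -> (kissing_vectors C L #<= `I_k)%card).

Definition cross_polytope (R : realType) (n : nat) : set 'rV[R]_n :=
  [set v | \sum_(i < n) `|v ord0 i| <= 1].
Arguments cross_polytope : clear implicits.

(* Main.v *)
(* The lattice D4+ has 40 vectors of l1-norm 2: the 8 vectors +-2e_i, the 24
   vectors +-e_i +- e_j, and 8 vectors with all coordinates +-1/2.

   Conversely let L have minimum at least 2, and let K be its set of vectors of
   norm 2 up to sign; we need at most 20 of them. Two vectors of K that are
   congruent modulo 2L have disjoint supports, and for each i at most one vector
   of K is dominated by i, i.e. has |v_i| > 1. Since L / 2L has 15 nonzero
   classes, it is enough to find 5 vectors of K that meet every pair of
   congruent vectors. A pair without a dominated vector is of the form
   e_a +- e_b, e_c +- e_d, so link a and b when L contains e_a + e_b or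
   e_a - e_b. If not all indices are linked, there is at most one such pair, and
   the at most 4 dominated vectors together with one member of that pair do. If
   all are linked, but L does not contain D4, then L contains no 2e_a and one
   sign only for each pair of indices, and for a suitable plane {a, b} the
   vectors dominated by a or b and the three vectors e_a +- e_x do. If L contains
   D4, then K consists of vectors 2e_a, e_a +- e_b and (+-1/2, +-1/2, +-1/2,
   +-1/2) and is counted directly. *)
Require Import Defs.
From mathcomp Require Import all_boot all_order all_algebra.
From mathcomp Require Import all_classical all_reals all_analysis.
From mathcomp Require Import finmap lra zify.

Set Implicit Arguments.
Unset Strict Implicit.
Unset Printing Implicit Defensive.

Import Order.TTheory GRing.Theory Num.Theory.
Import numFieldNormedType.Exports.

Local Open Scope classical_set_scope.
Local Open Scope ring_scope.

(** * Counting with duplicate-free lists *)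

(** An infinite set would contain [n.+1] distinct elements, so a bound on lists also yields
    finiteness. *)
Lemma card_le_uniq (T : choiceType) (A : set T) (n : nat) :
  (forall s, uniq s -> {in s, forall x, A x} -> (size s <= n)%N) ->
  (A #<= `I_n)%card.
Proof.
move=> sizeA; have [finA|infA] := pselect (finite_set A); last first.
  have [B BA] := infinite_set_fset n.+1 infA.
  by rewrite ltnNge sizeA // => x xB; apply: BA.
have /finite_fsetP[X AX] := finA; rewrite AX in sizeA *.
have /card_eq_fsetP XX : #|` X| = #|` X| by [].
by rewrite (card_le_eql XX) card_le_II sizeA.
Qed.

Lemma card_ge_uniq (T : choiceType) (A : set T) (s : seq T) :
  uniq s -> {in s, forall x, A x} -> (`I_(size s) #<= A)%card.
Proof.
move=> us sA; have /card_eq_fsetP XX : #|` [fset x in s]%fset| = size s.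
  by rewrite card_fseq undup_id.
by rewrite -(card_le_eql XX); apply: subset_card_le => x /=; rewrite inE => /sA.
Qed.

Lemma exp_bounded_leq (m q B : nat) :
  (forall k, (m ^ k <= q ^ k * B)%N) -> (m <= q)%N.
Proof.
move=> mqB; case: (posnP q) => [q0|q_gt0].
  by have := mqB 1; rewrite q0 expn1 mul0n.
rewrite leqNgt; apply/negP => qm.
(* Bernoulli's inequality (1 + 1/q)^k >= 1 + k/q, cleared of denominators; at k = q B it exceeds
   B. *)
have bern k : (q ^ k * (q + k) <= q.+1 ^ k * q)%N.
  elim: k => [|k IHk]; first by rewrite addn0.
  apply: (@leq_trans (q.+1 * (q ^ k * (q + k)))).
    rewrite expnS -mulnA [leqRHS]mulnCA [leqLHS]mulnCA leq_mul2l; nia.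
  by rewrite expnS -mulnA leq_mul2l IHk orbT.
have := bern (q * B).
have : (q.+1 ^ (q * B) <= q ^ (q * B) * B)%N.
  apply: leq_trans (mqB _); case: (q * B)%N => [|k]; first by rewrite !expn0.
  by rewrite leq_exp2r.
have : (0 < q ^ (q * B))%N by rewrite expn_gt0 q_gt0.
move: (q ^ _)%N (q.+1 ^ _)%N => X Y; nia.
Qed.

(** Sending a covered element to an index that covers it is injective. *)
Lemma size_cover (T : eqType) (I : finType) (P : I -> pred T) (s : seq T) :
  uniq s -> (forall i, {in s &, forall u v, P i u -> P i v -> u = v}) ->
  (size [seq v <- s | [exists i, P i v]] <= #|I|)%N.
Proof.
move=> us P1; set t := [seq v <- s | [exists i, P i v]].
have [->|t0] := eqVneq t [::]; first by [].
have [i0 _] : exists i : I, true.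
  case: t t0 (filter_all (fun v => [exists i, P i v]) s : all _ t) => // x l _ /=.
  by case/andP=> /existsP[i _] _; exists i.
pose f v := odflt i0 [pick i | P i v].
have fP v : v \in t -> P (f v) v.
  rewrite mem_filter => /andP[/existsP[i Piv] _]; rewrite /f.
  by case: pickP => [//|/(_ i)]; rewrite Piv.
have inj_f : {in t &, injective f}.
  move=> u v ut vt fuv; apply: (P1 (f u)); rewrite ?fP //.
  - by move: ut; rewrite mem_filter => /andP[].
  - by move: vt; rewrite mem_filter => /andP[].
  - by rewrite fuv fP.
have : uniq (map f t) by rewrite map_inj_in_uniq // filter_uniq.
by rewrite -(size_map f) => /card_uniqP <-; apply: max_card.
Qed.

(** * Lattices of l1-minimum at least 2 and congruence modulo 2L *)

Definition l1norm (R : realType) (n : nat) (v : 'rV[R]_n) : R :=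
  \sum_i `|v ord0 i|.

Lemma l1norm0 (R : realType) (n : nat) : l1norm (0 : 'rV[R]_n) = 0.
Proof. by rewrite /l1norm big1 // => i _; rewrite mxE normr0. Qed.

Lemma l1norm_ge0 (R : realType) (n : nat) (v : 'rV[R]_n) : 0 <= l1norm v.
Proof. exact: sumr_ge0. Qed.

Lemma l1normN (R : realType) (n : nat) (v : 'rV[R]_n) : l1norm (- v) = l1norm v.
Proof. by apply: eq_bigr => i _; rewrite mxE normrN. Qed.

Lemma l1normZ (R : realType) (n : nat) (a : R) (v : 'rV[R]_n) :
  l1norm (a *: v) = `|a| * l1norm v.
Proof. by rewrite /l1norm mulr_sumr; apply: eq_bigr => i _; rewrite mxE normrM. Qed.

Lemma l1normD (R : realType) (n : nat) (u v : 'rV[R]_n) :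
  l1norm (u + v) <= l1norm u + l1norm v.
Proof.
by rewrite /l1norm -big_split /=; apply: ler_sum => i _; rewrite mxE ler_normD.
Qed.

Lemma l1normMn (R : realType) (n : nat) (v : 'rV[R]_n) (k : nat) :
  l1norm (v *+ k) = l1norm v *+ k.
Proof. by rewrite -scaler_nat l1normZ normr_nat mulr_natl. Qed.

(** The working form of the packing condition; [packing2_of_lattice] and [lattice_of_packing2]
    relate it to [packing_lattice]. *)
Definition packing2 (R : realType) (n : nat) (L : set 'rV[R]_n) : Prop :=
  zmod_closed [in L] /\ (forall v, L v -> l1norm v < 2 -> v = 0).

Definition congr_mod2 (R : realType) (n : nat) (L : set 'rV[R]_n)
    (u v : 'rV[R]_n) : Prop :=
  exists2 w, L w & u - v = w *+ 2.

Section Packing2.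
Variables (R : realType) (n : nat) (L : set 'rV[R]_n).
Hypothesis HL : packing2 L.
Implicit Types u v w : 'rV[R]_n.

Lemma p2_0 : L 0.
Proof. by have [[/set_mem]] := HL. Qed.

Lemma p2_sub u v : L u -> L v -> L (u - v).
Proof. by have [[_ LB] _] := HL => Lu Lv; apply: set_mem; apply: LB; apply: mem_set. Qed.

Lemma p2_opp v : L v -> L (- v).
Proof. by rewrite -sub0r; apply/p2_sub/p2_0. Qed.

Lemma p2_add u v : L u -> L v -> L (u + v).
Proof. by move=> Lu /p2_opp; rewrite -{2}[v]opprK; apply: p2_sub. Qed.

Lemma p2_muln v k : L v -> L (v *+ k).
Proof.
by move=> Lv; elim: k => [|k IHk]; [apply: p2_0|rewrite mulrS; apply: p2_add].
Qed.

Lemma p2_min v : L v -> v != 0 -> 2 <= l1norm v.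
Proof. by move=> Lv; apply: contraNT; rewrite -ltNge => /(HL.2 v Lv) ->. Qed.

Lemma congr_mod2_sym u v : congr_mod2 L u v -> congr_mod2 L v u.
Proof.
move=> [w Lw uv]; exists (- w); first exact: p2_opp.
by rewrite mulNrn -uv opprB.
Qed.

Lemma congr_mod2_trans v u w : congr_mod2 L u v -> congr_mod2 L v w -> congr_mod2 L u w.
Proof.
move=> [x Lx uv] [y Ly vw]; exists (x + y); first exact: p2_add.
by rewrite mulrnDl -uv -vw addrA subrK.
Qed.

Lemma congr_mod2N u v : L v -> congr_mod2 L u v -> congr_mod2 L u (- v).
Proof.
move=> Lv [w Lw uv]; exists (w + v); first exact: p2_add.
by rewrite mulrnDl -uv mulr2n addrA subrK opprK.
Qed.

(* [|u_i - v_i| / 2 + |u_i + v_i| / 2] is the larger of [|u_i|] and [|v_i|], so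
   the vectors [(u - v) / 2] and [(u + v) / 2] of [L] can both have norm at
   least 2 only if the supports of [u] and [v] are disjoint. *)
Lemma congr_mod2_disjoint u v (i : 'I_n) :
  L v -> l1norm u = 2 -> l1norm v = 2 -> u != v -> u != - v ->
  congr_mod2 L u v -> u ord0 i = 0 \/ v ord0 i = 0.
Proof.
move=> Lv nu nv uv uNv [w Lw uvw].
have two0 (x : 'rV[R]_n) : x *+ 2 == 0 -> x = 0.
  by rewrite -scaler_nat scaler_eq0 pnatr_eq0 /= => /eqP.
have w0 : w != 0 by apply: contra_neq uv => w0; apply/eqP; rewrite -subr_eq0 uvw w0 mul0rn.
have uvw' : u + v = (w + v) *+ 2 by rewrite mulrnDl -uvw mulr2n addrA subrK.
have wv0 : w + v != 0.
  by apply: contra_neq uNv => w0'; apply/eqP; rewrite -addr_eq0 uvw' w0' mul0rn.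
have h1 : 4 <= l1norm (u - v).
  by rewrite uvw l1normMn; have := p2_min Lw w0; rewrite mulr2n; lra.
have h2 : 4 <= l1norm (u + v).
  by rewrite uvw' l1normMn; have := p2_min (p2_add Lw Lv) wv0; rewrite mulr2n; lra.
(* The defect of coordinate [j] in the triangle inequalities for [u - v] and [u + v]. It is
   nonnegative and its sum is at most 8 - 4 - 4 = 0. *)
pose f j := (`|u ord0 j| + `|v ord0 j|) *+ 2 - `|(u - v) ord0 j| - `|(u + v) ord0 j|.
have f_ge0 j : 0 <= f j.
  rewrite /f !mxE mulr2n.
  have := ler_normB (u ord0 j) (v ord0 j); have := ler_normD (u ord0 j) (v ord0 j); lra.
have : \sum_j f j == 0.
  rewrite eq_le sumr_ge0 // andbT /f !sumrB sumrMnl big_split /=.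
  by move: h1 h2 nu nv; rewrite /l1norm; lra.
rewrite psumr_eq0 // => /allP /(_ i); rewrite mem_index_enum => /(_ isT) /eqP.
rewrite /f !mxE mulr2n => fi0.
have := ler_normB (u ord0 i) (v ord0 i); have := ler_normD (u ord0 i) (v ord0 i).
move=> hD hB; have /(congr1 (fun x => x ^+ 2)) : `|u ord0 i - v ord0 i| = `|u ord0 i + v ord0 i|.
  by lra.
rewrite !real_normK ?num_real // sqrrB sqrrD => uvi.
have /eqP : u ord0 i * v ord0 i = 0 by move: uvi; rewrite mulr2n; lra.
by rewrite mulf_eq0 => /orP[/eqP|/eqP]; [left|right].
Qed.

(** After a change of sign both [i]-th coordinates exceed 1. The difference then has norm at most 4
    minus twice the smaller of them, hence less than 2, and vanishes. *)
Lemma dominated_unique u v (i : 'I_n) :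
  L u -> L v -> l1norm u = 2 -> l1norm v = 2 ->
  1 < `|u ord0 i| -> 1 < `|v ord0 i| -> u = v \/ u = - v.
Proof.
have key x y : L x -> L y -> l1norm x = 2 -> l1norm y = 2 ->
    1 < x ord0 i -> 1 < y ord0 i -> x = y.
  move=> Lx Ly; rewrite /l1norm (bigD1 i) //= => nx; rewrite (bigD1 i) //= => ny xi yi.
  apply/eqP; rewrite -subr_eq0; apply/eqP/(HL.2 _ (p2_sub Lx Ly)).
  rewrite /l1norm (bigD1 i) //=.
  have : \sum_(j < n | j != i) `|(x - y) ord0 j| <=
      \sum_(j < n | j != i) `|x ord0 j| + \sum_(j < n | j != i) `|y ord0 j|.
    by rewrite -big_split; apply: ler_sum => j _; rewrite !mxE ler_normB.
  rewrite [(x - y) ord0 i]mxE [(- y) ord0 i]mxE.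
  rewrite (gtr0_norm (lt_trans ltr01 xi)) in nx.
  rewrite (gtr0_norm (lt_trans ltr01 yi)) in ny.
  by case: (ger0P (x ord0 i - y ord0 i)) => ?; lra.
have Nn (x : 'rV[R]_n) : l1norm x = 2 -> l1norm (- x) = 2 by rewrite l1normN.
have No (x : 'rV[R]_n) : (- x) ord0 i = - x ord0 i by rewrite mxE.
move=> Lu Lv nu nv; have := p2_opp Lu; have := p2_opp Lv => LNv LNu.
case: (ger0P (u ord0 i)) => ui; case: (ger0P (v ord0 i)) => vi u1 v1.
- by left; apply: key.
- by right; apply: key; rewrite ?No //; apply: Nn.
- by right; rewrite -[u]opprK; congr (- _); apply: key; rewrite ?No //; apply: Nn.
- by left; apply: oppr_inj; apply: key; rewrite ?No //; apply: Nn.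
Qed.

(* A volume argument: the [m ^ k] points [\sum_(j < k) 2 ^ j *: t_(i_j)] are
   distinct and lie in a box of side [O(2 ^ k)], which holds [O(2 ^ (n k))]
   points at mutual distance at least 2. *)
Lemma size_incongr_mod2 (t : seq 'rV[R]_n) :
  uniq t -> {in t, forall v, L v} -> {in t &, forall u v, congr_mod2 L u v -> u = v} ->
  (size t <= 2 ^ n)%N.
Proof.
move=> ut tL tC.
(* Expansions in base 2 with [k] digits from [t]. The last digit is determined modulo 2L, so
   distinct digit strings give distinct vectors. *)
pose S := fix S k : seq 'rV[R]_n :=
  if k is k'.+1 then [seq x + y *+ 2 | x <- t, y <- S k'] else [:: 0].
have SL k v : v \in S k -> L v.
  elim: k v => [|k IHk] v /=; first by rewrite inE => /eqP ->; apply: p2_0.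
  move=> /allpairsP[[x y] /= [xt yS ->]].
  by apply: p2_add; [apply: tL|apply: p2_muln; apply: IHk].
have Ssize k : size (S k) = (size t ^ k)%N.
  by elim: k => [//|k IHk] /=; rewrite size_allpairs IHk expnS.
have Suniq k : uniq (S k).
  elim: k => [//|k IHk] /=; rewrite allpairs_uniq //.
  move=> [x y] [x' y'] /allpairsP[[a b] /= [at_ bS [-> ->]]].
  move=> /allpairsP[[a' b'] /= [at' bS' [-> ->]]] E.
  have aa' : a = a'.
    apply: tC => //; exists (b' - b); first by apply: p2_sub; apply: (SL k).
    by rewrite mulrnBl; apply/eqP; rewrite subr_eq addrAC eq_sym subr_eq E addrC.
  move: E; rewrite -aa' => /addrI /eqP; rewrite -subr_eq0 -mulrnBl -scaler_nat.
  by rewrite scaler_eq0 pnatr_eq0 subr_eq0 /= => /eqP ->.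
pose b (v : 'rV[R]_n) i := (Num.truncn `|v ord0 i|).+1.
pose c := (\max_(v <- t) \max_(i < n) b v i)%N.
have cP v i : v \in t -> `|v ord0 i| <= c%:R.
  move=> vt; apply: ltW; apply: lt_le_trans (truncnS_gt _) _; rewrite ler_nat.
  have h1 : (b v i <= \max_(j < n) b v j)%N by apply: leq_bigmax.
  apply: leq_trans h1 _.
  exact: (@leq_bigmax_seq _ _ _ (fun v => \max_(j < n) b v j)%N v).
have Sbox k v i : v \in S k -> `|v ord0 i| <= (2 ^ k * c)%:R.
  (* The extra term [c] makes the induction close: c + 2 (2^k c - c) + c = 2^(k+1) c. *)
  suff H : v \in S k -> `|v ord0 i| + c%:R <= (2 ^ k * c)%:R.
    by move=> /H; have := ler0n R c; lra.
  elim: k v => [|k IHk] v /=.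
    by rewrite inE => /eqP ->; rewrite mxE normr0 add0r expn0 mul1n.
  move=> /allpairsP[[x y] /= [xt yS ->]].
  have := cP x i xt; have := IHk _ yS; rewrite expnS -mulnA natrM mulr2n !mxE.
  have := ler_normD (x ord0 i) (y ord0 i + y ord0 i).
  have := ler_normD (y ord0 i) (y ord0 i); lra.
(* It remains to place the points of [S k] injectively in a grid of (2^k (2nc + 1))^n cells. *)
apply: (@exp_bounded_leq _ _ ((n * c).*2.+1 ^ n)) => k; rewrite -Ssize.
rewrite -expnM [(n * k)%N]mulnC expnM -expnMn.
set M := (2 ^ k * (n * c).*2.+1)%N.
have M0 : (0 < M)%N by rewrite muln_gt0 expn_gt0.
(* The shift makes coordinates nonnegative. The factor [n] makes cells of side 1/n, so that two
   points of one cell are at l1-distance at most 1. *)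
pose y v i : R := n%:R * (v ord0 i + (2 ^ k * c)%:R).
have y_ge0 v i : v \in S k -> 0 <= y v i.
  by move=> /(Sbox k v i); rewrite ler_norml => /andP[? _]; apply: mulr_ge0 => //; lra.
have yM v i : v \in S k -> (Num.truncn (y v i) < M)%N.
  move=> vS; have := y_ge0 v i vS => /truncn_itv /andP[yl _].
  rewrite -(ltr_nat R); apply: le_lt_trans yl _.
  have : y v i <= n%:R * (2 ^ k * c).*2%:R.
    apply: ler_wpM2l => //; have := Sbox k v i vS.
    by rewrite ler_norml -addnn natrD => /andP[_ ?]; lra.
  move/le_lt_trans; apply; rewrite -natrM ltr_nat /M.
  have : (0 < 2 ^ k)%N by rewrite expn_gt0.
  move: (2 ^ k)%N => X; rewrite -!muln2; nia.
(* The default value of [insubd] is never taken on [S k], by [yM]. *)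
pose code v := [ffun i : 'I_n => insubd (Ordinal M0) (Num.truncn (y v i))].
have codeI : {in S k &, injective code}.
  move=> u v uS vS /ffunP uv; apply/eqP; rewrite -subr_eq0; apply/eqP.
  apply: HL.2; first by apply: p2_sub; apply: (SL k).
  have nuv i : n%:R * `|(u - v) ord0 i| <= 1.
    have := congr1 val (uv i); rewrite !ffunE !val_insubd !yM // => tuv.
    have /truncn_itv := y_ge0 u i uS; have /truncn_itv := y_ge0 v i vS.
    rewrite tuv -[(_.+1)]addn1 natrD => /andP[? ?] /andP[? ?].
    rewrite -[n%:R]normr_nat -normrM !mxE mulrBr.
    have -> : n%:R * u ord0 i - n%:R * v ord0 i = y u i - y v i.
      by rewrite /y; lra.
    by rewrite ler_norml; lra.
  rewrite /l1norm; have [n0|n0] := posnP n.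
    by rewrite big1 // => i; have := ltn_ord i; rewrite {2}n0.
  have n0' : 0 < n%:R :> R by rewrite ltr0n.
  have : n%:R * (\sum_i `|(u - v) ord0 i|) <= n%:R.
    rewrite mulr_sumr; apply: le_trans (ler_sum _ (fun i _ => nuv i)) _.
    by rewrite sumr_const card_ord.
  move=> H; apply: (@le_lt_trans _ _ 1); last by lra.
  by rewrite -(ler_pM2l n0') mulr1.
have := max_card [in map code (S k)].
by rewrite (card_uniqP _) ?map_inj_in_uniq // size_map card_ffun !card_ord.
Qed.

(* Removing the covered vectors leaves representatives of distinct nonzero
   classes modulo [2 L]. *)
Lemma size_congr_mod2_cover (I : finType) (P : I -> pred 'rV[R]_n) (s : seq 'rV[R]_n) :
  uniq s -> {in s, forall v, L v /\ l1norm v = 2} ->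
  (forall i, {in s &, forall u v, P i u -> P i v -> u = v}) ->
  {in s &, forall u v, u != v -> congr_mod2 L u v -> exists i, P i u || P i v} ->
  (size s < 2 ^ n + #|I|)%N.
Proof.
move=> us sK P1 Pcov.
pose q v := [exists i, P i v].
rewrite -(count_predC q s) addnC -addSn -!size_filter leq_add //; last exact: size_cover.
(* Prepending 0 accounts for the zero class and makes the bound strict. *)
rewrite -[X in (X <= _)%N]/(size (0 :: [seq v <- s | predC q v])).
have nz v : v \in s -> ~ congr_mod2 L v 0.
  move=> /sK[Lv nv] [w Lw]; rewrite subr0 => vw.
  have : l1norm w < 2 by move: nv; rewrite vw l1normMn mulr2n; lra.
  by move/(HL.2 _ Lw) => w0; move: nv; rewrite vw w0 mul0rn l1norm0; lra.
have s0 : 0 \notin s.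
  by apply/negP => /nz; apply; exists 0; [apply: p2_0|rewrite mul0rn subrr].
apply: size_incongr_mod2.
- by rewrite /= filter_uniq // mem_filter (negPf s0) andbF.
- move=> v; rewrite inE => /orP[/eqP ->|]; first exact: p2_0.
  by rewrite mem_filter => /andP[_ /sK[]].
- move=> u v; rewrite !inE !mem_filter /=.
  case/orP=> [/eqP ->|/andP[qu us']]; case/orP=> [/eqP -> //|/andP[qv vs]].
  + by move=> /congr_mod2_sym /nz; case/(_ vs).
  + by move/nz; case/(_ us').
  move=> uv; apply/eqP; apply/negPn/negP => /Pcov /(_ uv) [//|//|i /orP[Pi|Pi]].
    by case/negP: qu; apply/existsP; exists i.
  by case/negP: qv; apply/existsP; exists i.
Qed.

End Packing2.

(** * Coordinates in dimension four and links between indices *)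

Section Dimension4.
Variables (R : realType) (L : set 'rV[R]_4).
Hypothesis HL : packing2 L.
Implicit Types (u v w : 'rV[R]_4) (a b c d : 'I_4) (s t : R).

Lemma uniq4_mem a b c d (i : 'I_4) : uniq [:: a; b; c; d] -> i \in [:: a; b; c; d].
Proof.
move=> abcd; have /(uniq_min_size abcd) : {subset [:: a; b; c; d] <= enum 'I_4}.
  by move=> j _; rewrite mem_enum.
by rewrite size_enum_ord => -[] // _ ->; rewrite mem_enum.
Qed.

Lemma uniq4_exists a b : a != b -> exists c d, uniq [:: a; b; c; d].
Proof.
move=> ab; have /eqP : #|[set~ a] :\ b| = 2.
  by have := cardsC1 a; rewrite (cardsD1 b) !inE eq_sym ab card_ord => -[].
case/cards2P => c [d [cd E]]; exists c, d.
have : c \in [set~ a] :\ b by rewrite E !inE eqxx.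
have : d \in [set~ a] :\ b by rewrite E !inE eqxx orbT.
rewrite !inE /= !inE => /andP[db da] /andP[cb ca].
by rewrite /= ?inE ?negb_or ab cd [a == c]eq_sym ca [a == d]eq_sym da [b == c]eq_sym cb [b == d]eq_sym db.
Qed.

Lemma l1norm4 a b c d v : uniq [:: a; b; c; d] ->
  l1norm v = `|v ord0 a| + `|v ord0 b| + `|v ord0 c| + `|v ord0 d|.
Proof.
move=> abcd; rewrite /l1norm -big_enum /= (perm_big [:: a; b; c; d]) /=.
  by rewrite !big_cons big_nil addr0 !addrA.
apply: uniq_perm; rewrite ?enum_uniq // => i.
by rewrite mem_enum uniq4_mem.
Qed.

Lemma rowBE u v (i : 'I_4) : (u - v) ord0 i = u ord0 i - v ord0 i.
Proof. by rewrite !mxE. Qed.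

Lemma row4P a b c d u v : uniq [:: a; b; c; d] ->
  u ord0 a = v ord0 a -> u ord0 b = v ord0 b ->
  u ord0 c = v ord0 c -> u ord0 d = v ord0 d -> u = v.
Proof.
move=> abcd ua ub uc ud; apply/rowP => i.
by have := uniq4_mem i abcd; rewrite !inE => /or4P[] /eqP ->.
Qed.

(** Signs are reals of absolute value 1, so that one formula serves for e_a + e_b and e_a - e_b. *)
Definition pair_vec a b s : 'rV[R]_4 := delta_mx ord0 a + s *: delta_mx ord0 b.

Lemma pair_vecE a b s (i : 'I_4) :
  pair_vec a b s ord0 i = (i == a)%:R + s * (i == b)%:R.
Proof. by rewrite !mxE eqxx. Qed.

Lemma normr1P s : `|s| = 1 -> s = 1 \/ s = -1.
Proof. by case: (ger0P s) => _ h; [left|right; rewrite -h opprK]. Qed.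

Lemma norm_eq_sign s t : `|s| = `|t| -> exists2 e : R, `|e| = 1 & s = e * t.
Proof.
move=> /eqP; rewrite eqr_norm2 => /orP[] /eqP ->.
  by exists 1; rewrite ?normr1 ?mul1r.
by exists (-1); rewrite ?normrN1 ?mulN1r.
Qed.

Lemma p2_sign s v : `|s| = 1 -> L v -> L (s *: v).
Proof.
move=> /normr1P[] -> Lv; first by rewrite scale1r.
by rewrite scaleN1r; apply: p2_opp.
Qed.

Definition linked a b : Prop := exists2 s, `|s| = 1 & L (pair_vec a b s).

Definition has_double a : Prop := L (delta_mx ord0 a *+ 2).

Definition has_D4 : Prop :=
  forall a b s, a != b -> `|s| = 1 -> L (pair_vec a b s).

Lemma pair_vec_sym a b s : `|s| = 1 -> L (pair_vec a b s) -> L (pair_vec b a s).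
Proof.
move=> s1 /(p2_sign s1); congr L; rewrite /pair_vec scalerDr scalerA addrC.
by case: (normr1P s1) => ->; rewrite ?mulrNN mulr1 scale1r.
Qed.

(** (e_a + s e_b) - s (e_b + t e_c) = e_a - s t e_c. *)
Lemma pair_vec_trans b a c s t : `|s| = 1 ->
  L (pair_vec a b s) -> L (pair_vec b c t) -> L (pair_vec a c (- (s * t))).
Proof.
move=> s1 Lab /(p2_sign s1) /(p2_sub HL Lab); congr L.
by rewrite /pair_vec scalerDr opprD addrA addrK scalerA scaleNr.
Qed.

Lemma linked_sym a b : linked a b -> linked b a.
Proof. by move=> [s s1 Ls]; exists s => //; apply: pair_vec_sym. Qed.

Lemma linked_trans b a c : linked a b -> linked b c -> linked a c.
Proof.
move=> [s s1 Ls] [t t1 Lt]; exists (- (s * t)); last exact: (pair_vec_trans s1 Ls).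
by rewrite normrN normrM s1 t1 mulr1.
Qed.

Lemma linked_all a b c d : uniq [:: a; b; c; d] ->
  linked a b -> linked c d -> linked a c -> forall x y, x != y -> linked x y.
Proof.
move=> abcd ab cd ac.
have H x : x = a \/ linked x a.
  have := uniq4_mem x abcd; rewrite !inE => /or4P[] /eqP ->; [by left|right..].
  - exact: linked_sym.
  - exact: linked_sym.
  - by apply: linked_trans (linked_sym ac); apply: linked_sym.
move=> x y; case: (H x) => [->|xa]; case: (H y) => [->|ya] //; first by rewrite eqxx.
  by move=> _; apply: linked_sym.
by move=> _; apply: linked_trans xa (linked_sym ya).
Qed.

Lemma double_of_pairs a b s t : `|s| = 1 -> `|t| = 1 -> s != t ->
  L (pair_vec a b s) -> L (pair_vec a b t) -> has_double a.
Proof.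
move=> s1 t1 st Ls /(p2_add HL Ls); congr L; rewrite /pair_vec addrACA -scalerDl.
have -> : s + t = 0.
  by move: st; case: (normr1P s1) => ->; case: (normr1P t1) => ->;
    rewrite ?eqxx // => _; lra.
by rewrite scale0r addr0 mulr2n.
Qed.

(** Subtracting a link at [a] from 2 e_a gives the link of opposite sign. Pairs without [a] are
    obtained by going through [a]. *)
Lemma D4_of_double a :
  (forall x y, x != y -> linked x y) -> has_double a -> has_D4.
Proof.
move=> lnk Da.
have La b s : a != b -> `|s| = 1 -> L (pair_vec a b s).
  move=> ab s1; have [t t1 Lt] := lnk a b ab.
  have := p2_sub HL Da Lt.
  have -> : delta_mx ord0 a *+ 2 - pair_vec a b t = pair_vec a b (- t).
    by rewrite mulr2n /pair_vec opprD addrA addrK scaleNr.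
  by case: (normr1P s1) => ->; case: (normr1P t1) Lt => ->; rewrite ?opprK.
move=> b c s bc s1; have [Eab|ab] := eqVneq a b.
  by rewrite -Eab; apply: La => //; rewrite Eab.
have [ac|ac] := eqVneq a c; first by rewrite -ac; apply: pair_vec_sym => //; apply: La.
have -> : s = - (1 * - s) by rewrite mul1r opprK.
apply: (@pair_vec_trans a); rewrite ?normr1 //; last by apply: La; rewrite ?normrN.
by apply: pair_vec_sym; rewrite ?normr1 //; apply: La; rewrite ?normr1.
Qed.

Lemma pair_vec_of_coords a b v : a != b -> l1norm v = 2 ->
  `|v ord0 a| = 1 -> `|v ord0 b| = 1 ->
  v = v ord0 a *: pair_vec a b (v ord0 a * v ord0 b).
Proof.
move=> ab nv va vb; have [c [d abcd]] := uniq4_exists ab.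
have := nv; rewrite (l1norm4 _ abcd) va vb => ncd.
have vc : v ord0 c = 0.
  by apply: normr0_eq0; have := normr_ge0 (v ord0 c); have := normr_ge0 (v ord0 d); lra.
have vd : v ord0 d = 0.
  by apply: normr0_eq0; have := normr_ge0 (v ord0 c); have := normr_ge0 (v ord0 d); lra.
have := abcd; rewrite /= !inE !negb_or => /and4P[/and3P[_ ac ad] /andP[bc bd] _ _].
have va2 : v ord0 a * v ord0 a = 1 by case: (normr1P va) => ->; rewrite ?mulrNN mulr1.
apply: (row4P abcd); rewrite mxE pair_vecE ?vc ?vd.
- by rewrite eqxx (negPf ab) mulr0 addr0 mulr1.
- by rewrite eqxx eq_sym (negPf ab) add0r mulr1 mulrA va2 mul1r.
- by rewrite ![c == _]eq_sym (negPf ac) (negPf bc) mulr0 addr0 mulr0.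
- by rewrite ![d == _]eq_sym (negPf ad) (negPf bd) mulr0 addr0 mulr0.
Qed.

Lemma pair_vec_mem a b v : a != b -> L v -> l1norm v = 2 ->
  `|v ord0 a| = 1 -> `|v ord0 b| = 1 -> L (pair_vec a b (v ord0 a * v ord0 b)).
Proof.
move=> ab Lv nv va vb; have := p2_sign va Lv.
rewrite {2}(pair_vec_of_coords ab nv va vb) scalerA.
by case: (normr1P va) => ->; rewrite ?mulrNN mulr1 scale1r.
Qed.

Lemma linked_of_coords a b v : a != b -> L v -> l1norm v = 2 ->
  `|v ord0 a| = 1 -> `|v ord0 b| = 1 -> linked a b.
Proof.
move=> ab Lv nv va vb; exists (v ord0 a * v ord0 b); first by rewrite normrM va vb mulr1.
exact: pair_vec_mem.
Qed.

(** Neither vector is a multiple of a unit vector, so each support has at least two indices; being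
    disjoint among four indices, they have exactly two each. *)
Lemma disjoint_split u v : l1norm u = 2 -> l1norm v = 2 ->
  (forall i : 'I_4, u ord0 i = 0 \/ v ord0 i = 0) ->
  (forall i : 'I_4, `|u ord0 i| != 2 /\ `|v ord0 i| != 2) ->
  exists a b c d, [/\ uniq [:: a; b; c; d],
    [/\ u ord0 a != 0, u ord0 b != 0, u ord0 c = 0 & u ord0 d = 0] &
    [/\ v ord0 a = 0, v ord0 b = 0, v ord0 c != 0 & v ord0 d != 0]].
Proof.
move=> nu nv uv0 uv2.
have [a ua] : exists a, u ord0 a != 0.
  apply: contrapT => u0; move: nu; rewrite /l1norm big1 => [|i _]; first by lra.
  by apply/normr0P/eqP; apply: contrapT => ui; apply: u0; exists i; apply/eqP.
have [b ab ub] : exists2 b, a != b & u ord0 b != 0.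
  apply: contrapT => u0; move: nu; rewrite /l1norm (bigD1 a) //= big1 => [|i ia].
    by rewrite addr0 => ua2; have [] := uv2 a; rewrite ua2 eqxx.
  apply/normr0P/eqP; apply: contrapT => ui; apply: u0.
  by exists i; [rewrite eq_sym|apply/eqP].
have [c [d abcd]] := uniq4_exists ab; exists a, b, c, d.
have va : v ord0 a = 0 by case: (uv0 a) ua => // ->; rewrite eqxx.
have vb : v ord0 b = 0 by case: (uv0 b) ub => // ->; rewrite eqxx.
have := nv; rewrite (l1norm4 _ abcd) va vb normr0 !add0r => vcd.
have vc : v ord0 c != 0.
  by apply/eqP => vc; have [_] := uv2 d; rewrite -vcd vc normr0 add0r eqxx.
have vd : v ord0 d != 0.
  by apply/eqP => vd; have [_] := uv2 c; rewrite -vcd vd normr0 addr0 eqxx.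
have uc : u ord0 c = 0 by case: (uv0 c) vc => // ->; rewrite eqxx.
have ud : u ord0 d = 0 by case: (uv0 d) vd => // ->; rewrite eqxx.
by split.
Qed.

(** * Kissing vectors up to sign, and the bound for lattices containing D4 *)

Definition antipode_free (r : seq 'rV[R]_4) : Prop :=
  [/\ uniq r, {in r, forall v, L v /\ l1norm v = 2} &
      {in r &, forall u v, u != - v}].

Section Bounds.
Variable r : seq 'rV[R]_4.
Hypothesis Hr : antipode_free r.

Lemma antipode_sign_eq u v s : u \in r -> v \in r -> `|s| = 1 -> u = s *: v -> u = v.
Proof.
have [_ _ rN] := Hr => ur vr /normr1P[] ->; first by rewrite scale1r.
by rewrite scaleN1r => /eqP; rewrite (negPf (rN u v ur vr)).
Qed.

Lemma antipode_dominated_eq a u v : u \in r -> v \in r ->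
  1 < `|u ord0 a| -> 1 < `|v ord0 a| -> u = v.
Proof.
have [_ rK rN] := Hr => ur vr ua va; have [Lu nu] := rK u ur; have [Lv nv] := rK v vr.
case: (dominated_unique HL Lu Lv nu nv ua va) => // /eqP.
by rewrite (negPf (rN u v ur vr)).
Qed.

Lemma antipode_congr_disjoint u v a : u \in r -> v \in r -> u != v ->
  congr_mod2 L u v -> u ord0 a = 0 \/ v ord0 a = 0.
Proof.
have [_ rK rN] := Hr => ur vr uv; have [Lu nu] := rK u ur; have [Lv nv] := rK v vr.
by apply: congr_mod2_disjoint => //; apply: rN.
Qed.

Lemma antipode_pair_eq a b u v : a != b -> u \in r -> v \in r ->
  `|u ord0 a| = 1 -> `|u ord0 b| = 1 -> `|v ord0 a| = 1 -> `|v ord0 b| = 1 ->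
  u ord0 a * u ord0 b = v ord0 a * v ord0 b -> u = v.
Proof.
have [_ rK _] := Hr => ab ur vr ua ub va vb E.
have [_ nu] := rK u ur; have [_ nv] := rK v vr.
apply: (@antipode_sign_eq _ _ (u ord0 a * v ord0 a)) => //.
  by rewrite normrM ua va mulr1.
rewrite {1}(pair_vec_of_coords ab nu ua ub) {2}(pair_vec_of_coords ab nv va vb) scalerA E.
by congr (_ *: _); case: (normr1P va) => ->; rewrite -mulrA ?mulrNN !mulr1.
Qed.

(** Subtracting a suitable vector of D4 shows that every other vector has all coordinates +-1/2. The
    cover has 4 indices for dominated vectors, 12 for the e_a +- e_b and 4 for the half-integral
    ones. *)
Lemma bound_D4 : has_D4 -> (size r <= 20)%N.
Proof.
move=> D4; have [ur rK rN] := Hr.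
pose half v := [forall i, `|v ord0 i| == 2^-1].
pose e0 : 'I_4 := inord 0; pose e1 : 'I_4 := inord 1.
pose e2 : 'I_4 := inord 2; pose e3 : 'I_4 := inord 3.
have e_uniq : uniq [:: e0; e1; e2; e3].
  by rewrite /= !inE -!val_eqE /= !inordK.
(* For [a != b] the order of [a] and [b] encodes the sign in [e_a +- e_b]; a
   vector with all coordinates [+- 1/2] is determined up to sign by its first
   three signs, since two of them cannot differ in one coordinate only. *)
pose P (x : 'I_4 * 'I_4 + bool * bool) v :=
  match x with
  | inl (a, b) => if a == b then 1 < `|v ord0 a| else
      [&& `|v ord0 a| == 1, `|v ord0 b| == 1 & (0 < v ord0 a * v ord0 b) == (a < b)%N]
  | inr (p, q) =>
      [&& half v, (0 < v ord0 e0 * v ord0 e1) == p & (0 < v ord0 e0 * v ord0 e2) == q]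
  end.
have cov v : v \in r -> [exists x, P x v].
  move=> vr; have [Lv nv] := rK v vr.
  have [/existsP[a va]|/existsPn small] := boolP [exists a, 1 < `|v ord0 a|].
    by apply/existsP; exists (inl (a, a)); rewrite /P eqxx.
  have [/existsP[a /existsP[b /and3P[ab va vb]]]|nopair] :=
    boolP [exists a, exists b, [&& a != b, `|v ord0 a| == 1 & `|v ord0 b| == 1]].
    have [lt|] := boolP ((0 < v ord0 a * v ord0 b) == (a < b)%N).
      by apply/existsP; exists (inl (a, b)); rewrite /P (negPf ab) va vb.
    (* With the wrong order for its sign, the vector is covered by the swapped pair. *)
    move=> ne; have ba : b != a by rewrite eq_sym.
    apply/existsP; exists (inl (b, a)); rewrite /P (negPf ba) va vb /=.
    have -> : (b < a)%N = ~~ (a < b)%N by rewrite -leqNgt [RHS]leq_eqVlt val_eqE (negPf ba).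
    by move: ne; rewrite mulrC; case: (0 < _); case: (a < b)%N.
  have pair_le a b : a != b -> `|v ord0 a| + `|v ord0 b| <= 1.
    move=> ab; have [c [d abcd]] := uniq4_exists ab.
    have := abcd; rewrite /= !inE !negb_or => /and4P[/and3P[_ ac ad] /andP[bc bd] cd _].
    pose sg (x : R) : R := if 0 <= x then 1 else -1.
    have sg1 x : `|sg x| = 1 by rewrite /sg; case: ifP; rewrite ?normrN1 ?normr1.
    have sgx x : `|x| <= 1 -> `|x - sg x| = 1 - `|x|.
      by rewrite /sg; case: (ger0P x) => x0 x1; [rewrite ler0_norm|rewrite ger0_norm]; lra.
    have sgs x y : sg x * (sg x * sg y) = sg y.
      by rewrite mulrA; case: (normr1P (sg1 x)) => ->; rewrite ?mulrNN mulr1 mul1r.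
    (* The vector +-e_a +- e_b with the signs of [v]: the norm of [v - w] is 4 - 2 (|v_a| + |v_b|),
       and it is at least 2. *)
    pose w := sg (v ord0 a) *: pair_vec a b (sg (v ord0 a) * sg (v ord0 b)).
    have Lw : L w by apply: p2_sign => //; apply: D4 => //; rewrite normrM !sg1 mulr1.
    have wE i : w ord0 i = sg (v ord0 a) * (i == a)%:R + sg (v ord0 b) * (i == b)%:R.
      by rewrite mxE pair_vecE mulrDr mulrA sgs.
    have wa : w ord0 a = sg (v ord0 a).
      by rewrite wE eqxx (negPf ab) mulr0 addr0 mulr1.
    have wb : w ord0 b = sg (v ord0 b).
      by rewrite wE eqxx eq_sym (negPf ab) mulr0 add0r mulr1.
    have wc : w ord0 c = 0.
      by rewrite wE ![c == _]eq_sym (negPf ac) (negPf bc) !mulr0 addr0.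
    have wd : w ord0 d = 0.
      by rewrite wE ![d == _]eq_sym (negPf ad) (negPf bd) !mulr0 addr0.
    have vw : v - w != 0.
      rewrite subr_eq0; apply: contra nopair => /eqP vw.
      by apply/existsP; exists a; apply/existsP; exists b; rewrite ab vw wa wb !sg1 eqxx.
    have := p2_min HL (p2_sub HL Lv Lw) vw; rewrite (l1norm4 _ abcd) !rowBE wa wb wc wd !subr0.
    rewrite !sgx; [|by rewrite leNgt small|by rewrite leNgt small].
    by have := nv; rewrite (l1norm4 _ abcd); lra.
  (* Complementary pairs sum to 2 in total, so all six pair sums equal 1. *)
  have hv : half v.
    have h01 := pair_le e0 e1; have h02 := pair_le e0 e2; have h03 := pair_le e0 e3.
    have h12 := pair_le e1 e2; have h13 := pair_le e1 e3; have h23 := pair_le e2 e3.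
    have := e_uniq; rewrite /= !inE !negb_or.
    case/and4P=> /and3P[/h01 {}h01 /h02 {}h02 /h03 {}h03].
    move=> /andP[/h12 {}h12 /h13 {}h13] /h23 {}h23 _.
    have := nv; rewrite (l1norm4 _ e_uniq) => n4.
    apply/forallP => i; apply/eqP; have := uniq4_mem i e_uniq.
    by rewrite !inE => /or4P[] /eqP ->; lra.
  apply/existsP; exists (inr (0 < v ord0 e0 * v ord0 e1, 0 < v ord0 e0 * v ord0 e2)).
  by rewrite /P hv !eqxx.
have P1 x : {in r &, forall u v, P x u -> P x v -> u = v}.
  move=> u v ur' vr; case: x => [[a b]|[p q]] /=.
    case: eqVneq => [_|ab]; first exact: antipode_dominated_eq.
    case/and3P=> /eqP ua /eqP ub /eqP uab /and3P[/eqP va /eqP vb /eqP vab].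
    apply: (antipode_pair_eq ab) => //; move: uab; rewrite -vab.
    by case: (normr1P ua) => ->; case: (normr1P ub) => ->;
      case: (normr1P va) => ->; case: (normr1P vb) => ->;
      rewrite ?mulrNN ?mulr1 ?mul1r ?ltr01 ?ltr0N1.
  case/and3P=> /forallP uh /eqP u1 /eqP u2 /and3P[/forallP vh /eqP v1 /eqP v2].
  have [s s1 us] : exists2 s, `|s| = 1 & u ord0 e0 = s * v ord0 e0.
    by apply: norm_eq_sign; rewrite (eqP (uh _)) (eqP (vh _)).
  apply: (antipode_sign_eq ur' vr s1); apply/eqP; rewrite -subr_eq0; apply/eqP.
  have [[Lu _] [Lv _]] := (rK u ur', rK v vr).
  apply: HL.2; first by apply: p2_sub => //; apply: p2_sign.
  have key j : (0 < u ord0 e0 * u ord0 j) = (0 < v ord0 e0 * v ord0 j) ->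
      u ord0 j = s * v ord0 j.
    have [t t1 ut] : exists2 t, `|t| = 1 & u ord0 j = t * v ord0 j.
      by apply: norm_eq_sign; rewrite (eqP (uh _)) (eqP (vh _)).
    have nz i : v ord0 i != 0 by rewrite -normr_gt0 (eqP (vh i)) invr_gt0 ltr0n.
    have : v ord0 e0 * v ord0 j != 0 by rewrite mulf_neq0.
    rewrite us ut mulrACA; set z := v ord0 e0 * _.
    case: (normr1P s1) => ->; case: (normr1P t1) => ->; rewrite ?mulrNN ?mulr1 ?mul1r //;
      by rewrite ?mulN1r oppr_gt0; case: ltgtP.
  have w1 := key e1 (etrans u1 (esym v1)); have w2 := key e2 (etrans u2 (esym v2)).
  rewrite (l1norm4 _ e_uniq) !mxE us w1 w2 !subrr normr0 !add0r.
  apply: le_lt_trans (ler_normB _ _) _.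
  by rewrite normrM s1 (eqP (uh _)) (eqP (vh _)); lra.
have := size_cover ur P1; rewrite card_sum !card_prod !card_ord card_bool.
by rewrite (all_filterP _) //; apply/allP.
Qed.

End Bounds.
End Dimension4.

(** * Lattices that do not contain D4 *)

Section LinkedBounds.
Variables (R : realType) (L : set 'rV[R]_4) (r : seq 'rV[R]_4).
Hypotheses (HL : packing2 L) (Hr : antipode_free L r).
Implicit Types (u v w : 'rV[R]_4) (a b c d : 'I_4) (s t : R).

(* A vector [u] of norm 2 with support [{a, x}] and dominated by [x]: its
   difference with a signed [e_x + s e_a] of [L] is dominated by [a]. *)
Lemma dominated_companion a x u : x != a -> linked L x a ->
  L u -> `|u ord0 x| + `|u ord0 a| = 2 -> l1norm u = 2 ->
  1 < `|u ord0 x| -> u ord0 a != 0 ->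
  exists z, [/\ L z, l1norm z = 2, 1 < `|z ord0 a| & z ord0 x != 0].
Proof.
move=> xa [s s1 Ls] Lu uxa nu ux ua.
have [c [d abcd]] := uniq4_exists xa.
have := abcd; rewrite /= !inE !negb_or => /and4P[/and3P[_ xc xd] /andP[ac ad] cd _].
have [p p1 up] : exists2 p : R, `|p| = 1 & u ord0 x = p * `|u ord0 x|.
  by apply: norm_eq_sign; rewrite normr_id.
(* Here |z_x| = |u_x| - 1 and |z_a| <= 1 + |u_a|; as [z] has norm at least 2 and |u_x| + |u_a| = 2,
   the latter is an equality. *)
pose z := u - p *: pair_vec x a s.
have Lz : L z by apply: p2_sub => //; apply: p2_sign.
have := nu; rewrite (l1norm4 _ abcd) => n4.
have uc : u ord0 c = 0.
  by apply: normr0_eq0; have := normr_ge0 (u ord0 c); have := normr_ge0 (u ord0 d); lra.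
have ud : u ord0 d = 0.
  by apply: normr0_eq0; have := normr_ge0 (u ord0 c); have := normr_ge0 (u ord0 d); lra.
have zE i : z ord0 i = u ord0 i - p * ((i == x)%:R + s * (i == a)%:R).
  by rewrite /z rowBE; congr (_ - _); rewrite mxE pair_vecE.
have zx : `|z ord0 x| = `|u ord0 x| - 1.
  rewrite zE eqxx (negPf xa) mulr0 addr0 mulr1 up.
  rewrite -[X in _ - X]mulr1 -mulrBr normrM p1 mul1r normrM p1 normr_id mul1r.
  by rewrite ger0_norm; lra.
have za : z ord0 a = u ord0 a - p * s.
  by rewrite zE eqxx eq_sym (negPf xa) add0r mulr1.
have zc : z ord0 c = 0.
  by rewrite zE uc ![c == _]eq_sym (negPf xc) (negPf ac) mulr0 addr0 mulr0 subr0.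
have zd : z ord0 d = 0.
  by rewrite zE ud ![d == _]eq_sym (negPf xd) (negPf ad) mulr0 addr0 mulr0 subr0.
have zx0 : z ord0 x != 0 by rewrite -normr_gt0 zx; lra.
have nz : l1norm z = `|u ord0 x| - 1 + `|z ord0 a|.
  by rewrite (l1norm4 _ abcd) zx zc zd normr0 !addr0.
have z2 : 2 <= l1norm z.
  by apply: (p2_min HL Lz); apply: contra_neq zx0 => ->; rewrite mxE.
have ua_gt0 : 0 < `|u ord0 a| by rewrite normr_gt0.
have zaE : `|z ord0 a| = 1 + `|u ord0 a|.
  move: z2; rewrite nz za.
  have : `|p * s| = 1 by rewrite normrM p1 s1 mulr1.
  move=> /normr1P[] ->; rewrite ?opprK; move: uxa ua_gt0;
    case: (ger0P (u ord0 a)) => ua' uxa ua_gt0.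
  - by rewrite (@ler0_norm _ (u ord0 a - 1)) => [?|]; lra.
  - by rewrite (@ler0_norm _ (u ord0 a - 1)) => [?|]; lra.
  - by rewrite (@ger0_norm _ (u ord0 a + 1)) => [?|]; lra.
  - by rewrite (@ger0_norm _ (u ord0 a + 1)) => [?|]; lra.
by exists z; split; rewrite ?nz ?zaE //; lra.
Qed.

Lemma bound_linked :
  (forall a b, a != b -> linked L a b) -> ~ has_D4 L -> (size r <= 20)%N.
Proof.
move=> lnk nD4; have [ur rK rN] := Hr.
have nodbl a : ~ has_double L a by move=> /(D4_of_double HL lnk).
have no2 v a : L v -> l1norm v = 2 -> `|v ord0 a| != 2.
  move=> Lv nv; apply/eqP => va; apply: (nodbl a).
  have v0 i : i != a -> v ord0 i = 0.
    move=> ia; apply: normr0_eq0; move: nv; rewrite /l1norm (bigD1 a) //= (bigD1 i) //= va.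
    have := normr_ge0 (v ord0 i).
    have : 0 <= \sum_(j < 4 | (j != a) && (j != i)) `|v ord0 j| by apply: sumr_ge0.
    lra.
  have [p p1 vp] : exists2 p : R, `|p| = 1 & v ord0 a = p * 2.
    by apply: norm_eq_sign; rewrite va normr_nat.
  have := p2_sign HL p1 Lv; congr L; apply/rowP => i; rewrite mulr2n !mxE eqxx /=.
  have [->|ia] := eqVneq i a; last by rewrite v0 // mulr0 addr0.
  by rewrite vp; case: (normr1P p1) => -> /=; lra.
(* The choice of the plane: one containing a vector dominated by [a], or any plane at all if no
   vector of [r] supported on two indices is dominated. *)
have [a [b [ab Hab]]] : exists a b, a != b /\
    ((exists w, [/\ w \in r, 1 < `|w ord0 a| & `|w ord0 a| + `|w ord0 b| = 2]) \/
     forall u x y, u \in r -> x != y -> `|u ord0 x| + `|u ord0 y| = 2 ->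
       `|u ord0 x| <= 1).
  have [[a [b [w [ab wr wa wab]]]]|none] := pselect (exists a b w,
      [/\ a != b, w \in r, 1 < `|w ord0 a| & `|w ord0 a| + `|w ord0 b| = 2]).
    by exists a, b; split=> //; left; exists w.
  exists ord0, ord_max; split=> //; right=> u x y ur' xy uxy; rewrite leNgt.
  by apply/negP => ux; apply: none; exists x, y, u.
(* If some vector of the plane [{a, b}] is dominated by [a], then by
   [dominated_companion] no vector of a plane [{a, x}] with [x != b] is
   dominated at all, so that [+- (e_a +- e_x)] is its only vector in [r]. *)
pose P (k : option 'I_4) v :=
  if k is Some x then
    if x == a then 1 < `|v ord0 a| else (`|v ord0 a| == 1) && (`|v ord0 x| == 1)
  else 1 < `|v ord0 b|.
have P1 k : {in r &, forall u v, P k u -> P k v -> u = v}.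
  move=> u v ur' vr; case: k => [x|] /=; last exact: (antipode_dominated_eq HL Hr).
  case: eqVneq => [_|xa]; first exact: (antipode_dominated_eq HL Hr).
  have [[Lu nu] [Lv nv]] := (rK u ur', rK v vr).
  case/andP=> /eqP ua /eqP ux /andP[/eqP va /eqP vx].
  have ax : a != x by rewrite eq_sym.
  apply: (antipode_pair_eq Hr ax) => //.
  (* Both signs on one pair would add up to 2 e_a. *)
  apply: contrapT => /eqP ne; apply: (nodbl a).
  apply: (double_of_pairs HL _ _ ne); rewrite ?normrM ?ua ?ux ?va ?vx ?mulr1 //.
    exact: pair_vec_mem.
  exact: pair_vec_mem.
(* In a congruent pair, the member with [a] in its support lies in some plane {a, x}; this shows
   that it is covered. *)
have Q u x : u \in r -> x != a -> u ord0 a != 0 -> u ord0 x != 0 ->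
    `|u ord0 x| + `|u ord0 a| = 2 -> exists k, P k u.
  move=> ur' xa ua0 ux0 uax; have [Lu nu] := rK u ur'.
  have ax : a != x by rewrite eq_sym.
  have [ua|ua|ua] := ltgtP `|u ord0 a| 1.
  - have ux : 1 < `|u ord0 x| by lra.
    have [xb|xb] := eqVneq x b; first by exists None; rewrite /P -xb.
    case: Hab => [[w [wr wa wab]]|/(_ u x a ur' xa uax)]; last by lra.
    have [Lw nw] := rK w wr.
    have [z [Lz nz za zx]] := dominated_companion xa (lnk _ _ xa) Lu uax nu ux ua0.
    have wx : w ord0 x = 0.
      apply: normr0_eq0; move: nw; rewrite /l1norm (bigD1 a) //= (bigD1 b) 1?eq_sym //=.
      rewrite (bigD1 x) /=; last by rewrite xa xb.
      have := normr_ge0 (w ord0 x).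
      have : 0 <= \sum_(j < 4 | (j != a) && (j != b) && (j != x)) `|w ord0 j| by apply: sumr_ge0.
      lra.
    (* The companion [z] must be [w] or [- w], but [w] vanishes at [x]. *)
    case: (dominated_unique HL Lz Lw nz nw za wa) zx => ->; rewrite ?mxE wx ?oppr0 eqxx //.
  - by exists (Some a); rewrite /P eqxx.
  - exists (Some x); rewrite /P (negPf xa) ua eqxx /=; apply/eqP; lra.
(* Five covering predicates give a size below 16 + 5. *)
have := size_congr_mod2_cover HL ur rK P1; rewrite card_option card_ord addnC; apply.
move=> u v ur' vr uv cuv.
have [[Lu nu] [Lv nv]] := (rK u ur', rK v vr).
have disj i := antipode_congr_disjoint HL Hr i ur' vr uv cuv.
have [x [y [z [t [xyzt [ux uy uz ut] [vx vy vz vt]]]]]] :=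
  disjoint_split nu nv disj (fun i => conj (no2 u i Lu nu) (no2 v i Lv nv)).
have uxy : `|u ord0 x| + `|u ord0 y| = 2.
  by have := nu; rewrite (l1norm4 _ xyzt) uz ut normr0 !addr0.
have vzt : `|v ord0 z| + `|v ord0 t| = 2.
  by have := nv; rewrite (l1norm4 _ xyzt) vx vy normr0 !add0r.
have := xyzt; rewrite /= !inE !negb_or => /and4P[/and3P[xy _ _] _ zt _].
have := uniq4_mem a xyzt; rewrite !inE => /or4P[] /eqP aE; subst a.
- have [k Pk] := Q u y ur' (etrans (congr1 negb (eq_sym y x)) xy) ux uy (etrans (addrC _ _) uxy).
  by exists k; rewrite Pk.
- by have [k Pk] := Q u x ur' xy uy ux uxy; exists k; rewrite Pk.
- have [k Pk] := Q v t vr (etrans (congr1 negb (eq_sym t z)) zt) vz vt (etrans (addrC _ _) vzt).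
  by exists k; rewrite Pk orbT.
- by have [k Pk] := Q v z vr zt vt vz vzt; exists k; rewrite Pk orbT.
Qed.

(** Supports are two and two by [disjoint_split], and two absolute values of at most 1 with sum 2
    are both 1. *)
Lemma undominated_split u v : u \in r -> v \in r -> u != v -> congr_mod2 L u v ->
  (forall i, `|u ord0 i| <= 1 /\ `|v ord0 i| <= 1) ->
  exists a b c d, [/\ uniq [:: a; b; c; d],
    [/\ `|u ord0 a| = 1, `|u ord0 b| = 1, u ord0 c = 0 & u ord0 d = 0] &
    [/\ v ord0 a = 0, v ord0 b = 0, `|v ord0 c| = 1 & `|v ord0 d| = 1]].
Proof.
have [_ rK _] := Hr => ur vr uv cuv le1.
have [[Lu nu] [Lv nv]] := (rK u ur, rK v vr).
have disj i := antipode_congr_disjoint HL Hr i ur vr uv cuv.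
have ne2 i : `|u ord0 i| != 2 /\ `|v ord0 i| != 2.
  by have [? ?] := le1 i; rewrite !neq_lt; split; apply/orP; left; lra.
have [a [b [c [d [abcd [ua ub uc ud] [va vb vc vd]]]]]] := disjoint_split nu nv disj ne2.
have := nu; have := nv; rewrite !(l1norm4 _ abcd) uc ud va vb normr0 => nv4 nu4.
have [? _] := le1 a; have [? _] := le1 b; have [_ ?] := le1 c; have [_ ?] := le1 d.
by exists a, b, c, d; split=> //; split=> //; lra.
Qed.

(* With [u] and [v] congruent and likewise [u'] and [v'], the vector
   [(u + u' - v - v') / 2] links [{a, b}] to [{c, d}]. *)
Lemma undominated_unique u v u' v' a b c d : ~ (forall x y, x != y -> linked L x y) ->
  u \in r -> v \in r -> u' \in r -> v' \in r ->
  congr_mod2 L u v -> congr_mod2 L u' v' -> uniq [:: a; b; c; d] ->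
  [/\ `|u ord0 a| = 1, `|u ord0 b| = 1, u ord0 c = 0 & u ord0 d = 0] ->
  [/\ v ord0 a = 0, v ord0 b = 0, `|v ord0 c| = 1 & `|v ord0 d| = 1] ->
  [/\ `|u' ord0 a| = 1, `|u' ord0 b| = 1, u' ord0 c = 0 & u' ord0 d = 0] ->
  [/\ v' ord0 a = 0, v' ord0 b = 0, `|v' ord0 c| = 1 & `|v' ord0 d| = 1] ->
  u = u'.
Proof.
move=> nlnk ur vr ur' vr' [w1 Lw1 uv] [w2 Lw2 uv'] abcd.
move=> [ua ub uc ud] [va vb vc vd] [ua' ub' uc' ud'] [va' vb' vc' vd'].
have [_ rK rN] := Hr.
have one_nz x : `|x : R| = 1 -> x <> 0 by move=> x1 x0; move: x1; rewrite x0 normr0; lra.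
apply: contrapT => /eqP uu'.
(* Otherwise [u] and [u'] would be congruent, yet both are nonzero at [a]. *)
have vv' : v != v'.
  apply: contra_neq uu' => vv'; apply: contrapT => /eqP uu'.
  have cuu' : congr_mod2 L u u'.
    exists (w1 - w2); first exact: p2_sub.
    by rewrite mulrnBl -uv -uv' vv' opprB addrA subrK.
  by case: (antipode_congr_disjoint HL Hr a ur ur' uu' cuu') => /one_nz; apply.
pose w := w1 + w2; have Lw : L w by apply: p2_add.
have wE i : w ord0 i *+ 2 = u ord0 i + u' ord0 i - (v ord0 i + v' ord0 i).
  have : (w *+ 2) ord0 i = ((u - v) + (u' - v')) ord0 i by rewrite mulrnDl uv uv'.
  by rewrite /w !mulr2n !mxE => ->; lra.
have signs (x y : R) : `|x| = 1 -> `|y| = 1 -> y = x \/ y = - x.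
  by move=> /normr1P[] -> /normr1P[] ->; rewrite ?opprK; [left|right|right|left].
(* The mixed case: [u'] agrees with [u] at one index and is opposite at the other, likewise [v']
   with [v]. Then [w] is u_x e_x - v_z e_z and links the two planes. Other sign patterns make two
   vectors equal or antipodal. *)
have fin (x y z t : 'I_4) : uniq [:: x; y; z; t] ->
    `|u ord0 x| = 1 -> `|u ord0 y| = 1 -> u' ord0 x = u ord0 x -> u' ord0 y = - u ord0 y ->
    `|v ord0 z| = 1 -> `|v ord0 t| = 1 -> v' ord0 z = v ord0 z -> v' ord0 t = - v ord0 t ->
    v ord0 x = 0 -> v ord0 y = 0 -> u ord0 z = 0 -> u ord0 t = 0 ->
    v' ord0 x = 0 -> v' ord0 y = 0 -> u' ord0 z = 0 -> u' ord0 t = 0 -> False.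
  move=> xyzt ux uy ux' uy' vz vt vz' vt' vx vy uz ut vx' vy' uz' ut'; apply: nlnk.
  have wx : w ord0 x = u ord0 x by have := wE x; rewrite ux' vx vx' mulr2n; lra.
  have wy : w ord0 y = 0 by have := wE y; rewrite uy' vy vy' mulr2n; lra.
  have wz : w ord0 z = - v ord0 z by have := wE z; rewrite uz uz' vz' mulr2n; lra.
  have wt : w ord0 t = 0 by have := wE t; rewrite ut ut' vt' mulr2n; lra.
  have nw : l1norm w = 2 by rewrite (l1norm4 _ xyzt) wx wy wz wt normrN ux vz normr0; lra.
  have := xyzt; rewrite /= !inE !negb_or => /and4P[/and3P[xy xz _] _ zt _].
  have [[Lu nu] [Lv nv]] := (rK u ur, rK v vr).
  apply: (linked_all HL xyzt).
  - exact: (linked_of_coords HL xy Lu nu ux uy).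
  - exact: (linked_of_coords HL zt Lv nv vz vt).
  - by apply: (linked_of_coords HL xz Lw nw); rewrite ?wx ?wz ?normrN.
have perm (x y z t : 'I_4) : uniq [:: x; y; z; t] = uniq [:: y; x; z; t].
  by apply/perm_uniq/permP => p /=; rewrite addnCA.
have perm' (x y z t : 'I_4) : uniq [:: x; y; z; t] = uniq [:: x; y; t; z].
  by apply/perm_uniq/permP => p /=; rewrite [(p z + _)%N]addnCA.
have eq4 (x y : 'rV[R]_4) : x ord0 a = y ord0 a -> x ord0 b = y ord0 b -> x ord0 c = y ord0 c ->
    x ord0 d = y ord0 d -> x == y.
  by move=> xa xb xc xd; apply/eqP/(row4P abcd).
have NE (x : 'rV[R]_4) (i : 'I_4) : (- x) ord0 i = - x ord0 i by rewrite mxE.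
have uNu' := rN u u' ur ur'; have vNv' := rN v v' vr vr'.
case: (signs _ _ ua ua') => ea; case: (signs _ _ ub ub') => eb.
- by case/negP: uu'; apply: eq4; rewrite ?ea ?eb ?uc ?ud ?uc' ?ud'.
- case: (signs _ _ vc vc') => ec; case: (signs _ _ vd vd') => ed.
  + by case/negP: vv'; apply: eq4; rewrite ?ec ?ed ?va ?vb ?va' ?vb'.
  + exact: (fin a b c d).
  + by apply: (fin a b d c) => //; rewrite -perm'.
  + by case/negP: vNv'; apply: eq4; rewrite NE ?ec ?ed ?va ?vb ?va' ?vb' ?opprK ?oppr0.
- case: (signs _ _ vc vc') => ec; case: (signs _ _ vd vd') => ed.
  + by case/negP: vv'; apply: eq4; rewrite ?ec ?ed ?va ?vb ?va' ?vb'.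
  + by apply: (fin b a c d) => //; rewrite -perm.
  + by apply: (fin b a d c) => //; rewrite -perm -perm'.
  + by case/negP: vNv'; apply: eq4; rewrite NE ?ec ?ed ?va ?vb ?va' ?vb' ?opprK ?oppr0.
- by case/negP: uNu'; apply: eq4; rewrite NE ?ea ?eb ?uc ?ud ?uc' ?ud' ?opprK ?oppr0.
Qed.

Lemma bound_unlinked : ~ (forall a b, a != b -> linked L a b) -> (size r <= 20)%N.
Proof.
move=> nlnk; have [ur rK rN] := Hr.
pose edge u v := [/\ u \in r, v \in r, u != v, congr_mod2 L u v &
  forall i : 'I_4, `|u ord0 i| <= 1 /\ `|v ord0 i| <= 1].
(* One vector meets all undominated congruent pairs. A first pair links [a] to [b] and [c] to [d]; a
   pair with other supports would link everything, and one with the same supports is handled by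
   [undominated_unique]. *)
have [u0 Hu0] : exists u0, forall u v, edge u v -> u = u0 \/ v = u0.
  have [[u0 [v0 [u0r v0r uv0 cuv0 le0]]]|none] := pselect (exists u0 v0, edge u0 v0); last first.
    (* Without such pairs any vector serves as [u0]. *)
    by exists 0 => u v uv; case: none; exists u, v.
  have [a [b [c [d [abcd U0 V0]]]]] := undominated_split u0r v0r uv0 cuv0 le0.
  have := abcd; rewrite /= !inE !negb_or => /and4P[/and3P[ab ac ad] /andP[bc bd] cd _].
  have [[Lu0 nu0] [Lv0 nv0]] := (rK u0 u0r, rK v0 v0r).
  have [[ua0 ub0 _ _] [_ _ vc0 vd0]] := (U0, V0).
  have lab : linked L a b by exact: (linked_of_coords HL ab Lu0 nu0 ua0 ub0).
  have lcd : linked L c d by exact: (linked_of_coords HL cd Lv0 nv0 vc0 vd0).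
  have nac : ~ linked L a c by move=> ?; apply: nlnk; apply: (linked_all HL abcd).
  have nad : ~ linked L a d.
    move=> l; apply: nac; apply: (linked_trans HL l); exact: linked_sym.
  have nbc : ~ linked L b c by move=> /(linked_trans HL lab).
  have main u v : edge u v -> `|u ord0 a| = 1 -> u0 = u.
    move=> [ur' vr uv cuv le] ua; have [[Lu nu] [Lv nv]] := (rK u ur', rK v vr).
    have [x [y [z [t [xyzt [ux uy uz ut] [vx vy vz vt]]]]]] := undominated_split ur' vr uv cuv le.
    have dich i : (`|u ord0 i| = 1 /\ v ord0 i = 0) \/ (u ord0 i = 0 /\ `|v ord0 i| = 1).
      by have := uniq4_mem i xyzt; rewrite !inE => /or4P[] /eqP ->; [left|left|right|right].
    have va : v ord0 a = 0 by case: (dich a) => -[] // ua'; move: ua; rewrite ua' normr0; lra.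
    case: (dich c) => -[uc vc].
      by case: nac; apply: (linked_of_coords HL ac Lu nu ua uc).
    case: (dich d) => -[ud vd].
      by case: nad; apply: (linked_of_coords HL ad Lu nu ua ud).
    case: (dich b) => -[ub vb]; last first.
      by case: nbc; apply: (linked_of_coords HL bc Lv nv vb vc).
    exact: (undominated_unique nlnk u0r v0r ur' vr cuv0 cuv abcd).
  exists u0 => u v E; have [ur' vr uv cuv le] := E.
  have [x [y [z [t [xyzt [ux uy _ _] [_ _ vz vt]]]]]] := undominated_split ur' vr uv cuv le.
  have [ua|va] : `|u ord0 a| = 1 \/ `|v ord0 a| = 1.
    by have := uniq4_mem a xyzt; rewrite !inE => /or4P[] /eqP ->; [left|left|right|right].
  - by left; rewrite (main u v E ua).
  - right; rewrite (main v u _ va) //; split=> //; first by rewrite eq_sym.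
      exact: congr_mod2_sym.
    by move=> i; have [] := le i.
pose P (k : option 'I_4) v := if k is Some a then 1 < `|v ord0 a| else v == u0.
have P1 k : {in r &, forall u v, P k u -> P k v -> u = v}.
  move=> u v ur' vr; case: k => [a|] /=; first exact: (antipode_dominated_eq HL Hr).
  by move=> /eqP -> /eqP ->.
have := size_congr_mod2_cover HL ur rK P1; rewrite card_option card_ord addnC; apply.
move=> u v ur' vr uv cuv.
have [[a ua]|u1] := pselect (exists a, 1 < `|u ord0 a|); first by exists (Some a); rewrite /P ua.
have [[a va]|v1] := pselect (exists a, 1 < `|v ord0 a|).
  by exists (Some a); rewrite /P va orbT.
exists None; case: (Hu0 u v) => [|->|->]; rewrite /P ?eqxx ?orbT //.
split=> // i; rewrite !leNgt; split; apply/negP => h; [apply: u1|apply: v1]; by exists i.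
Qed.

Lemma size_antipode_free : (size r <= 20)%N.
Proof.
have [D4|nD4] := pselect (has_D4 L); first exact: (bound_D4 HL Hr).
have [lnk|nlnk] := pselect (forall a b, a != b -> linked L a b); first exact: bound_linked.
exact: bound_unlinked.
Qed.

End LinkedBounds.

(** * The cross-polytope: gauge, interior and packing lattices *)

Lemma gauge_cross_polytope (R : realType) (n : nat) (v : 'rV[R]_n) :
  gauge_norm (cross_polytope R n) v = l1norm v.
Proof.
rewrite /gauge_norm; set S := [set r | _].
have Sv : S (l1norm v).
  split; first exact: l1norm_ge0.
  have [v0|v0] := eqVneq (l1norm v) 0.
    exists 0; first by rewrite /cross_polytope /= -/(l1norm 0) l1norm0.
    rewrite scaler0; apply/rowP => i; rewrite mxE; apply/esym/normr0_eq0/eqP.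
    by move/eqP: v0; rewrite psumr_eq0 // => /allP/(_ i); apply; rewrite mem_index_enum.
  exists ((l1norm v)^-1 *: v); last by rewrite scalerA divff // scale1r.
  rewrite /cross_polytope /= -/(l1norm (_ *: v)) l1normZ normfV ger0_norm ?l1norm_ge0 //.
  by rewrite mulVf.
have Slb : lbound S (l1norm v).
  move=> x [x0 [c Cc <-]]; rewrite l1normZ ger0_norm //.
  by rewrite -[leRHS]mulr1; apply: ler_wpM2l.
apply/eqP; rewrite eq_le; apply/andP; split.
  by apply: ge_inf => //; exists (l1norm v).
by apply: lb_le_inf => //; exists (l1norm v).
Qed.

Lemma translate_cross_polytope (R : realType) (n : nat) (v x : 'rV[R]_n) :
  translate (cross_polytope R n) v x <-> l1norm (x - v) <= 1.
Proof.
split=> [[c Cc <-]|xv]; first by rewrite addrK.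
by exists (x - v); rewrite ?subrK.
Qed.

Lemma interior_cross_polytope (R : realType) (n : nat) (v x : 'rV[R]_n) :
  interior (translate (cross_polytope R n) v) x <-> l1norm (x - v) < 1.
Proof.
split=> [/nbhs_ballP[e /= e0 xe]|xv].
(* Moving [x] away from [v] by the factor 1 + t stays in the ball, since t (N + 1) = e / 2 for N the
   norm of [x - v]; thus (1 + t) N <= 1. *)
- pose t := e / (2 * (l1norm (x - v) + 1)).
  have xv0 := l1norm_ge0 (x - v).
  have t0 : 0 < t by rewrite divr_gt0 //; lra.
  have : ball x e (x + t *: (x - v)).
    split=> // i j; rewrite [i]ord1 /ball /= !mxE opprD addrA subrr sub0r normrN normrM gtr0_norm //.
    have : `|x ord0 j - v ord0 j| <= l1norm (x - v).
      by rewrite /l1norm (bigD1 j) //= !mxE lerDl sumr_ge0.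
    move=> xvj; apply: (@le_lt_trans _ _ (t * (l1norm (x - v) + 1))).
      by rewrite ler_pM2l //; lra.
    rewrite /t invfM mulrA divfK; last by rewrite gt_eqF //; lra.
    by rewrite ltr_pdivrMr //; lra.
  move=> /xe /translate_cross_polytope.
  have -> : x + t *: (x - v) - v = (1 + t) *: (x - v).
    by rewrite scalerDl scale1r addrAC.
  by rewrite l1normZ gtr0_norm ?addr_gt0 // mulrDl mul1r; nra.
(* The ball is for the maximum norm, so the l1 displacement is at most n e; dividing by n + 1 covers
   n = 0 as well. *)
- apply/nbhs_ballP; pose e := (1 - l1norm (x - v)) / n.+1%:R.
  have n1 : 0 < n.+1%:R :> R by rewrite ltr0n.
  have e0 : 0 < e by rewrite divr_gt0 // subr_gt0.
  exists e => //= y xy; apply/translate_cross_polytope.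
  rewrite -(subrKA x); apply: le_trans (l1normD _ _) _.
  have : l1norm (y - x) <= n.+1%:R * e.
    apply: (@le_trans _ _ (\sum_(i < n) e)).
      by apply: ler_sum => i _; apply: ltW; have := xy.2 ord0 i; rewrite /ball /= !mxE distrC.
    by rewrite sumr_const card_ord -[e *+ n]mulr_natl; apply: ler_wpM2r; [exact: ltW|rewrite ler_nat].
  by rewrite /e mulrCA divff ?gt_eqF // mulr1; lra.
Qed.

(** If [v] had norm less than 2, its half would be interior to the translates at 0 and at [v]. *)
Lemma packing2_of_lattice (R : realType) (n : nat) (L : set 'rV[R]_n) :
  packing_lattice (cross_polytope R n) L -> packing2 L.
Proof.
move=> [[Lz _ _] Ltriv]; split=> // v Lv nv.
have L0 : L 0 by have [/set_mem] := Lz.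
apply: Ltriv => //; exists (2^-1 *: v); split; apply/interior_cross_polytope.
  have -> : 2^-1 *: v - v = - (2^-1 *: v).
    by rewrite -{2}[v]scale1r -scalerBl -scaleNr; congr (_ *: _); lra.
  by rewrite l1normN l1normZ ger0_norm ?invr_ge0 //; lra.
by rewrite subr0 l1normZ ger0_norm ?invr_ge0 //; lra.
Qed.

(** Two lattice points at distance less than 2 coincide; this gives disjoint interiors, and also
    discreteness, as the open unit ball around a lattice point contains no other. *)
Lemma lattice_of_packing2 (R : realType) (n : nat) (L : set 'rV[R]_n) (B : 'M[R]_n) :
  packing2 L -> row_free B -> (forall i, L (row i B)) ->
  packing_lattice (cross_polytope R n) L.
Proof.
move=> HL Bfree LB.
have min_dist u v : L u -> L v -> l1norm (u - v) < 2 -> u = v.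
  by move=> Lu Lv uv; apply/eqP; rewrite -subr_eq0; apply/eqP/(HL.2 _ (p2_sub HL Lu Lv)).
split.
  split; [exact: HL.1| |by exists B].
  move=> v Lv; split; first exact: mem_set.
  exists (interior (translate (cross_polytope R n) v)).
    by apply: open_nbhs_nbhs; split; [exact: open_interior|apply/interior_cross_polytope; rewrite subrr l1norm0].
  apply/seteqP; split=> [w [/interior_cross_polytope wv Lw]|w ->].
    by apply: min_dist => //; lra.
  by split=> //; apply/interior_cross_polytope; rewrite subrr l1norm0.
move=> u v Lu Lv [x [/interior_cross_polytope xu /interior_cross_polytope xv]].
apply: min_dist => //; rewrite -(subrKA x).
apply: le_lt_trans (l1normD _ _) _.
by rewrite -l1normN opprB; lra.
Qed.

(** * The upper bound 40 *)

Lemma kissing_bound (R : realType) (L : set 'rV[R]_4) :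
  packing_lattice (cross_polytope R 4) L ->
  (kissing_vectors (cross_polytope R 4) L #<= `I_40)%card.
Proof.
move=> /packing2_of_lattice HL; apply: card_le_uniq => s us sK.
(* A canonical choice between [v] and [- v]. The vectors equal to their representative and the
   remaining ones form two lists without antipodal pairs, of size at most 20 each. *)
pose rep (v : 'rV[R]_4) := choose (pred2 v (- v)) v.
have repN v : rep (- v) = rep v.
  rewrite /rep (@eq_choose _ _ (pred2 v (- v))); last first.
    by move=> u; rewrite /= opprK orbC.
  by apply: choose_id; rewrite /= eqxx ?orbT.
have rep_mem v : rep v = v \/ rep v = - v.
  have : pred2 v (- v) (rep v) by apply: chooseP; rewrite /= eqxx.
  by case/orP=> /eqP; [left|right].
have free (q : pred 'rV[R]_4) : (forall v, l1norm v = 2 -> q v -> ~~ q (- v)) ->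
    (size [seq v <- s | q v] <= 20)%N.
  move=> qN; apply: (size_antipode_free HL); split; first by rewrite filter_uniq.
    move=> v; rewrite mem_filter => /andP[_ /sK[Lv]].
    by rewrite gauge_cross_polytope.
  move=> u v; rewrite !mem_filter => /andP[qu _] /andP[qv /sK[_]].
  rewrite gauge_cross_polytope => nv; apply/eqP => uv.
  by have := qN v nv qv; rewrite -uv qu.
rewrite -(count_predC (fun v => rep v == v) s) -!size_filter -[40%N]/(20 + 20)%N.
have Nne (v : 'rV[R]_4) : l1norm v = 2 -> v != - v.
  move=> nv; apply/eqP => vN; have : v *+ 2 = 0 by rewrite mulr2n {2}vN subrr.
  move=> v2; have := congr1 (@l1norm R 4) v2; rewrite l1normMn l1norm0 nv mulr2n; lra.
apply: leq_add; apply: free => v nv /=; rewrite repN.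
  by move=> /eqP ->; apply: Nne.
by case: (rep_mem v) => ->; rewrite ?eqxx.
Qed.

(** * The lattice D4+ and its 40 vectors of norm 2 *)

(* Twice the coordinates of a vector of D4+, the union of D4 and of its
   translate by (1/2, 1/2, 1/2, 1/2), in the basis e_1 + e_1, e_1 + e_2,
   e_1 + e_3, (e_1 + e_2 + e_3 + e_4) / 2. *)
Definition D4plus_coord (z : int * int * int * int) (i : nat) : int :=
  let: (a, b, c, h) := z in
  nth 0 [:: 4 * a + 2 * b + 2 * c + h; 2 * b + h; 2 * c + h; h] i.

Definition D4plus_vec (R : realType) (z : int * int * int * int) : 'rV[R]_4 :=
  \row_i ((D4plus_coord z i)%:~R / 2).

Definition D4plus (R : realType) : set 'rV[R]_4 := range (@D4plus_vec R).
Arguments D4plus : clear implicits.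

Definition D4plus_norm (z : int * int * int * int) : nat :=
  (`|D4plus_coord z 0| + `|D4plus_coord z 1| + `|D4plus_coord z 2| + `|D4plus_coord z 3|)%N.

Lemma l1norm_D4plus (R : realType) (z : int * int * int * int) :
  l1norm (D4plus_vec R z) = (D4plus_norm z)%:R / 2.
Proof.
rewrite /l1norm !big_ord_recr big_ord0 /= add0r !mxE /D4plus_norm !natrD !mulrDl.
by rewrite !normrM !normfV !normr_nat -!intr_norm -!natr_absz.
Qed.

Lemma D4plus_vec_inj (R : realType) : injective (D4plus_vec R).
Proof.
move=> [[[a b] c] h] [[[a' b'] c'] h'] /rowP E.
have {}E i : D4plus_coord (a, b, c, h) i = D4plus_coord (a', b', c', h') i :> int.
  have [i4|i4] := ltnP i 4; last by rewrite /D4plus_coord !nth_default.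
  have := E (Ordinal i4); rewrite !mxE /= => /(mulIf _)/intr_inj; apply.
  by rewrite invr_eq0 pnatr_eq0.
move: (E 0%N) (E 1%N) (E 2%N) (E 3%N) => /= E0 E1 E2 E3.
have ha : a = a' by lia.
have hb : b = b' by lia.
have hc : c = c' by lia.
by rewrite ha hb hc E3.
Qed.

(** For odd [h] all four entries are odd and the sum of absolute values is at least 4. For even [h]
    the entries are even and their sum is divisible by 4, hence so is the sum of absolute values. *)
Lemma D4plus_norm_lt4 (z : int * int * int * int) :
  (D4plus_norm z < 4)%N -> z = (0, 0, 0, 0).
Proof.
move: z => [[[a b] c] h]; rewrite /D4plus_norm /= => H.
have h0 : h = 0 by lia.
have b0 : b = 0 by lia.
have c0 : c = 0 by lia.
have a0 : a = 0 by lia.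
by rewrite h0 a0 b0 c0.
Qed.

Lemma D4plus_packing2 (R : realType) : packing2 (D4plus R).
Proof.
have vec0 : D4plus_vec R (0, 0, 0, 0) = 0.
  apply/rowP => i; rewrite !mxE /D4plus_coord.
  by case: i => -[|[|[|[|]]]] //= _; rewrite mul0r.
split.
  split; first by apply/mem_set; exists (0, 0, 0, 0).
  move=> _ _ /set_mem[[[[a b] c] h] _ <-] /set_mem[[[[a' b'] c'] h'] _ <-].
  apply/mem_set; exists (a - a', b - b', c - c', h - h') => //.
  apply/rowP => i; rewrite !mxE -mulrBl -intrB; congr (_%:~R / 2).
  by case: i => -[|[|[|[|]]]] //= _; lia.
move=> _ [z _ <-]; rewrite l1norm_D4plus => nz.
by rewrite (@D4plus_norm_lt4 z) // -(ltr_nat R); lra.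
Qed.

Lemma D4plus_packing (R : realType) : packing_lattice (cross_polytope R 4) (D4plus R).
Proof.
pose e (i : 'I_4) (k : nat) : int := ((i : nat) == k)%:R.
pose B : 'M[R]_4 := \matrix_i D4plus_vec R (e i 0%N, e i 1%N, e i 2%N, e i 3%N).
apply: (@lattice_of_packing2 _ _ _ B); first exact: D4plus_packing2; last first.
  by move=> i; rewrite rowK; exists (e i 0%N, e i 1%N, e i 2%N, e i 3%N).
(* The basis matrix is lower triangular with diagonal 2, 1, 1, 1/2. *)
rewrite row_free_unit unitmxE unitfE det_trig.
  by rewrite !big_ord_recr big_ord0 /= !mxE /e /= mul1r !mulf_eq0 !intr_eq0 !invr_eq0 !pnatr_eq0.
apply/is_trig_mxP => i j; rewrite !mxE /e.
by case: i => -[|[|[|[|]]]] //= ?; case: j => -[|[|[|[|]]]] //= ? _; rewrite mul0r.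
Qed.

(** [box n] lists the integers from -n to n. Norm 4 in doubled coordinates is l1-norm 2; 40
    solutions lie in this box, and [kissing_bound] excludes any others. *)
Definition D4plus_shell : seq (int * int * int * int) :=
  let box n := [seq i%:Z - n%:Z | i <- iota 0 n.*2.+1] in
  [seq z <- [seq (x, h) | x <- [seq (y, c) | y <- [seq (a, b) | a <- box 1%N, b <- box 2%N],
                                              c <- box 2%N], h <- box 4%N]
  | D4plus_norm z == 4%N].

Lemma D4plus_shell_size : size D4plus_shell = 40%N.
Proof. by vm_compute. Qed.

Lemma D4plus_shell_uniq : uniq D4plus_shell.
Proof. by vm_compute. Qed.

Theorem theorem3 (R : realType) :
  is_lattice_kissing_number (cross_polytope R 4) 40.
Proof.
split; last exact: kissing_bound.
exists (D4plus R); first exact: D4plus_packing.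
rewrite card_eq_le; apply/andP; split; first exact/kissing_bound/D4plus_packing.
rewrite -D4plus_shell_size -(size_map (D4plus_vec R)); apply: card_ge_uniq.
  by rewrite (map_inj_uniq (@D4plus_vec_inj R)) D4plus_shell_uniq.
move=> _ /mapP[z + ->]; rewrite mem_filter => /andP[/eqP nz _].
split; first by exists z.
by rewrite gauge_cross_polytope l1norm_D4plus nz; lra.
Qed.
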